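(* Let $Q = (f^k, f \alpha)$ be an $\mathfrak{F}$-basic ideal of $O$ different from $fO$, where $f^k=N(Q)$ and $\alpha\in D\setminus O$. (i) $\mathfrak{F}^k$ is the minimum power of $\mathfrak{F}$ contained in $Q$, i.e. $k$ is the least integer $n\ge 0$ such that $\mathfrak{F}^n\subseteq Q$ (with $\mathfrak{F}^0=O$). (ii) If $Q$ is a $D$-module, then there are exactly $f+1$ ideals of $O$ lying properly between $Q$ and $fQ$, namely the pairwise distinct ideals $$J = (f^k, f^2 \alpha), \qquad J_a = (f^{k+1}, af^{k} + f\alpha),\quad a = 0, 1, \dots, f-1.$$ (iii) If $Q \ne QD$, then there is a unique ideal of $O$ lying properly between $Q$ and $fQ$, namely $J = (f^k, f^2 \alpha) = f QD$.
   Context: Let $d$ be a square-free integer ($d\neq 1$), $K=\mathbb{Q}(\sqrt d)$ and $D=\mathbb{Z}[\omega]$ its ring of integers, where $\omega=\sqrt d$ if $d\equiv 2,3 \pmod 4$ and $\omega=(1+\sqrt d)/2$ if $d\equiv 1\pmod 4$. Let $f$ be a prime number and $O=\mathbb{Z}[f\omega]$, the unique order of $K$ with $[D:O]=f$. The conductor of $O$ is $\mathfrak{F}=\{x\in O: xD\subseteq O\}=fD$; it is a prime ideal of $O$. An ideal of $O$ is $\mathfrak{F}$-primary if it is primary with radical $\mathfrak{F}$; an $\mathfrak{F}$-primary ideal is $\mathfrak{F}$-basic if it is not contained in $\mathfrak{F}^2$. For $\alpha,\beta\in O$, $(\alpha,\beta)=\alpha O+\beta O$. $N(Q)=|O/Q|$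 is the norm of an ideal $Q$ of $O$. $QD$ is the ideal of $D$ generated by $Q$, and $Q$ is a $D$-module if $QD=Q$. An ideal $J$ of $O$ lies properly between $Q$ and $fQ$ if $fQ\subsetneq J\subsetneq Q$. (Every $\mathfrak{F}$-basic ideal different from $fO$ can be written in the form $(f^k,f\alpha)$ with $f^k=N(Q)$ and $\alpha\in D\setminus O$.) *)

(* Defs.v *)
From HB Require Import structures.
From mathcomp Require Import all_boot all_order all_algebra all_field.
From mathcomp Require Import classical_sets cardinality.

Set Implicit Arguments.
Unset Strict Implicit.
Unset Printing Implicit Defensive.
Import Order.TTheory GRing.Theory Num.Theory.
Local Open Scope ring_scope.
Local Open Scope classical_set_scope.
Local Open Scope card_scope.

(* This excludes d = 0. *)
Definition squarefree (d : int) : Prop :=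
  forall m : int, (m ^+ 2 %| d)%Z -> `|m| = 1.

(* The orders of K, and the ideals of each order, are subsets of K. *)
Section Ideals.
Variable K : fieldType.
Implicit Types (x y a b : K) (S T I J G : set K) (n : nat).

(* Z[x] *)
Definition int_adjoin x : set K :=
  range (fun p : {poly int} => (map_poly intr p).[x]).

(* For a subring S, closure under opposites follows from the last clause. *)
Definition is_ideal S I : Prop :=
  [/\ I `<=` S, I 0, forall x y, I x -> I y -> I (x + y)
    & forall a x, S a -> I x -> I (a * x)].

Definition ideal2 S a b : set K := [set a * x + b * y | x in S & y in S].

Definition scale a I : set K := [set a * x | x in I].

Definition ideal_gen S G : set K := smallest (is_ideal S) G.

Definition ideal_mul I J : set K :=
  [set x | exists n (u v : 'I_n -> K),
     (forall i, I (u i) /\ J (v i)) /\ x = \sum_(i < n) u i * v i].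

(* The zeroth power is the whole ring S. *)
Definition ideal_pow S I n : set K := iter n (ideal_mul I) S.

Definition radical S I : set K :=
  [set x | S x /\ exists2 n, (0 < n)%N & I (x ^+ n)].

Definition is_primary S I : Prop :=
  [/\ is_ideal S I, I <> S
    & forall x y, S x -> S y -> I (x * y) -> I x \/ radical S I y].

Definition quotient S I : set (set K) :=
  [set [set x + y | y in I] | x in S].

Definition norm_is S I n : Prop := quotient S I #= `I_n.

Definition conductor S T : set K :=
  [set x | S x /\ forall y, T y -> S (x * y)].

Definition is_primary_for S P I : Prop := is_primary S I /\ radical S I = P.

Definition is_basic_for S P I : Prop :=
  is_primary_for S P I /\ ~ (I `<=` ideal_pow S P 2).

Definition ideals_between S a I : set (set K) :=
  [set J | [/\ is_ideal S J, scale a I `<` J & J `<` I]].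

End Ideals.

(* For d squarefree, d <> 1 and s ^+ 2 = d, the ring of integers of Q(s) is
   int_adjoin (quad_omega d s). *)
Definition quad_omega (K : fieldType) (d : int) (s : K) : K :=
  if (d %% 4)%Z == 1 then (1 + s) / 2%:R else s.

(* Main.v *)
Require Import Defs.
From mathcomp Require Import all_boot all_order all_algebra all_field.
From mathcomp Require Import classical_sets cardinality.
From mathcomp Require Import ring zify boolp.
Set Implicit Arguments.
Unset Strict Implicit.
Unset Printing Implicit Defensive.

Import Order.TTheory GRing.Theory Num.Theory.
Local Open Scope ring_scope.
Local Open Scope classical_set_scope.
Local Open Scope card_scope.

(** Write w for omega, with w^2 = t w - n, and theta = f w, so that D = Z + Z w
    and O = Z + Z theta.

    The norm condition puts Q in normal form. If alpha = u0 + v w, then f does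
    not divide v, so v is invertible modulo f^k; combining f alpha with
    theta f^k yields an element f beta of Q, with beta = u + w. An integer a > 0
    of Q satisfies |O/Q| <= a, because O = Z + Z f beta; hence the integers of Q
    are the multiples of f^k = |O/Q|, and Q has the Z-basis e1 = f^k,
    e2 = f beta ([basic_ideal_basis]). This gives (i): F^k lies in f^k D, which
    lies in Q, and F^i contains f^i, which is in Q only if i >= k.

    Now Q / fQ is a plane over F_f, so the groups strictly between fQ and Q are
    its f + 1 lines: [line f e1 e2 m l] is the preimage of the line spanned by
    m e1 + l e2 ([between_line]). To be an ideal of O, a line has to be stable
    under theta. Let N be the norm of beta. As Q is an ideal, f^2 N = c f^k for
    an integer c, and modulo fQ one has theta e1 = 0 and theta e2 = - c e1
    ([theta_span]). So theta acts nilpotently: if f divides c it acts as zero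
    and all lines are ideals, otherwise only the line of e1 is one
    ([between_lineP]). On the other hand w e1 always lies in Q, while
    w e2 = (u + t) e2 - f N lies in Q exactly when f^k divides f N, that is,
    when f divides c; so these two cases are the cases Q = QD and Q <> QD
    ([span_dmodule]).

    It remains to name the lines by generators. Modulo fQ, f alpha is v e2;
    thus J is the line of e1 and J_a the line of a e1 + v e2
    ([ideal2_line10], [ideal2_line]). If f does not divide c, then QD contains
    f^k and f N = c f^(k-1), hence f^(k-1), so QD = Z f^(k-1) + Z f beta and
    f QD is again the line of e1 ([line10_scaled]). *)

(** * Integers modulo a prime *)

Lemma prime_dvdzM (p : nat) (m n : int) :
  prime p -> (p %| m * n)%Z = (p %| m)%Z || (p %| n)%Z.
Proof. by move=> p_prime; rewrite !dvdzE abszM Euclid_dvdM. Qed.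

Lemma bezout_prime_power (p : nat) (m : int) (k : nat) :
  prime p -> ~~ (p %| m)%Z -> exists x y : int, x * m + y * p%:Z ^+ k = 1.
Proof.
move=> p_prime pNm.
have : coprimez m (p%:Z ^+ k).
  by apply: coprimezXr; rewrite coprimezE coprime_sym prime_coprime.
rewrite /coprimez => /eqP <-.
by have [x [y xy]] := Bezoutz m (p%:Z ^+ k); exists x, y.
Qed.

Lemma bezout_prime (p : nat) (m : int) :
  prime p -> ~~ (p %| m)%Z -> exists x y : int, x * m + y * p%:Z = 1.
Proof. by move=> p_prime /(bezout_prime_power 1 p_prime). Qed.

(** * Additive subgroups of a field *)

Section IntegralSpans.
Variable K : fieldType.
Implicit Types (x y : K) (J : set K).

Definition zclosed J :=
  forall (m n : int) x y, J x -> J y -> J (m%:~R * x + n%:~R * y).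

Definition zspan x y : set K :=
  [set z | exists m n : int, z = m%:~R * x + n%:~R * y].

Lemma zspan_closed x y : zclosed (zspan x y).
Proof.
move=> m n _ _ [a [b ->]] [c [e ->]].
by exists (m * a + n * c), (m * b + n * e); ring.
Qed.

Lemma zclosedZ {J} (m : int) {x} : zclosed J -> J x -> J (m%:~R * x).
Proof.
by move=> J_closed Jx; have := J_closed m 0 x x Jx Jx; rewrite mul0r addr0.
Qed.

Lemma zclosedD {J x y} : zclosed J -> J x -> J y -> J (x + y).
Proof. by move=> J_closed Jx /(J_closed 1 1 _ _ Jx); rewrite !mul1r. Qed.

Lemma zclosedB {J x y} : zclosed J -> J x -> J y -> J (x - y).
Proof.
by move=> J_closed Jx /(J_closed 1 (-1) _ _ Jx); rewrite mul1r mulN1r.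
Qed.

Lemma zclosed_bezout {J} (a b m n : int) {x} :
  zclosed J -> a * m + b * n = 1 -> J (m%:~R * x) -> J (n%:~R * x) -> J x.
Proof.
move=> J_closed abmn Jmx Jnx; have := J_closed a b _ _ Jmx Jnx.
suff -> : a%:~R * (m%:~R * x) + b%:~R * (n%:~R * x) = x by [].
have abmnK : (a * m + b * n)%:~R = 1 :> K by rewrite abmn.
by rewrite -[RHS]mul1r -[X in _ = X * _]abmnK; ring.
Qed.

End IntegralSpans.

(** * Groups between a lattice and f times it *)

Section Lines.
Variables (K : fieldType) (f : nat) (e1 e2 : K).
Hypothesis f_prime : prime f.
Hypothesis free : forall m n : int,
  m%:~R * e1 + n%:~R * e2 = 0 -> m = 0 /\ n = 0.
Implicit Types (m n a b : int) (J : set K).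

Let Q := zspan e1 e2.
Let q : K := f%:R.

(** The determinant condition modulo f makes membership testable and does not
    distinguish proportional pairs (m, n); if f divides m and n, the line is all
    of Q. *)
Definition line m n : set K :=
  [set z | exists m' n' : int,
    z = m'%:~R * e1 + n'%:~R * e2 /\ (f %| m' * n - n' * m)%Z].

Lemma zspan_inj m n m' n' :
  m%:~R * e1 + n%:~R * e2 = m'%:~R * e1 + n'%:~R * e2 -> m = m' /\ n = n'.
Proof.
move=> eq_mn; have [] : m - m' = 0 /\ n - n' = 0; last first.
  by move=> /subr0_eq-> /subr0_eq->.
by apply: free; move/eqP: eq_mn; rewrite -subr_eq0 => /eqP <-; ring.
Qed.

Lemma mem_line m n m' n' :
  line m n (m'%:~R * e1 + n'%:~R * e2) <-> (f %| m' * n - n' * m)%Z.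
Proof.
split=> [[a [b [/zspan_inj [-> ->]]]]//|dvd_mn].
by exists m', n'.
Qed.

Lemma mem_line1 m n : line m n e1 <-> (f %| n)%Z.
Proof.
have := mem_line m n 1 0; rewrite mul1r mul0r addr0.
by rewrite mul0r subr0 mul1r.
Qed.

Lemma line_gen m n : line m n (m%:~R * e1 + n%:~R * e2).
Proof. by apply/mem_line; rewrite mulrC subrr dvdz0. Qed.

Lemma line_sub m n : line m n `<=` Q.
Proof. by move=> _ [a [b [-> _]]]; exists a, b. Qed.

Lemma line_closed m n : zclosed (line m n).
Proof.
move=> x y _ _ [a [b [-> ab]]] [a' [b' [-> ab']]].
exists (x * a + y * a'), (x * b + y * b'); split; first by ring.
have -> : (x * a + y * a') * n - (x * b + y * b') * m =
  x * (a * n - b * m) + y * (a' * n - b' * m) by ring.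
by apply: rpredD; apply: dvdz_mull.
Qed.

Lemma scaled_sub_line m n : scale q Q `<=` line m n.
Proof.
move=> _ [_ [a [b ->]] <-]; exists (f%:Z * a), (f%:Z * b); split.
  by rewrite /q; ring.
by rewrite -!mulrA -mulrBr dvdz_mulr.
Qed.

Lemma mem_scaled m n :
  scale q Q (m%:~R * e1 + n%:~R * e2) <-> (f %| m)%Z && (f %| n)%Z.
Proof.
split=> [[_ [a [b ->]]]|/andP[/dvdzP[a ->] /dvdzP[b ->]]].
  have -> : q * (a%:~R * e1 + b%:~R * e2) =
    (f%:Z * a)%:~R * e1 + (f%:Z * b)%:~R * e2 by rewrite /q; ring.
  by move=> /zspan_inj [<- <-]; rewrite !dvdz_mulr.
by exists (a%:~R * e1 + b%:~R * e2); [exists a, b|rewrite /q; ring].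
Qed.

(** A vector (m', n') whose determinant with (m, n) vanishes modulo f is a
    multiple x (m, n) modulo f; x is found by inverting whichever of m and n is
    prime to f. *)
Lemma line_sub_closed J m n : zclosed J -> scale q Q `<=` J ->
  ~~ ((f %| m)%Z && (f %| n)%Z) -> J (m%:~R * e1 + n%:~R * e2) ->
  line m n `<=` J.
Proof.
move=> J_closed fQJ mnN0 Jmn _ [m' [n' [-> /dvdzP[c c_def]]]].
suff [x [a [b [m'E n'E]]]] : exists x a b : int,
    m' = x * m + f%:Z * a /\ n' = x * n + f%:Z * b.
  have -> : m'%:~R * e1 + n'%:~R * e2 =
    x%:~R * (m%:~R * e1 + n%:~R * e2) +
    1%:~R * (q * (a%:~R * e1 + b%:~R * e2)) by rewrite m'E n'E /q; ring.
  apply: J_closed => //; apply: fQJ.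
  by exists (a%:~R * e1 + b%:~R * e2); [exists a, b|].
have lin (u v : int) : u - v = 0 -> u = v by lia.
move: mnN0.
rewrite negb_and => /orP[] /(bezout_prime f_prime)[x [y xy]].
  exists (m' * x), (m' * y), (n' * y - x * c); split; apply: lin.
    rewrite -[X in X - _]mulr1 -xy; ring.
  rewrite -[X in X - _]mulr1 -xy.
  have -> : n' * (x * m + y * f%:Z) - (m' * x * n + f%:Z * (n' * y - x * c)) =
    x * (c * f%:Z - (m' * n - n' * m)) by ring.
  by rewrite c_def subrr mulr0.
exists (n' * x), (x * c + m' * y), (n' * y); split; apply: lin.
  rewrite -[X in X - _]mulr1 -xy.
  have -> : m' * (x * n + y * f%:Z) - (n' * x * m + f%:Z * (x * c + m' * y)) =
    x * ((m' * n - n' * m) - c * f%:Z) by ring.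
  by rewrite c_def subrr mulr0.
by rewrite -[X in X - _]mulr1 -xy; ring.
Qed.

(** By Cramer's rule, a group containing two vectors whose determinant is prime
    to f contains, with f Q, the whole of Q. *)
Lemma sub_line_closed J m n : zclosed J -> scale q Q `<=` J -> J `<` Q ->
  J (m%:~R * e1 + n%:~R * e2) -> J `<=` line m n.
Proof.
move=> J_closed fQJ [JQ QNJ] Jmn z Jz; have [m' [n' z_def]] := JQ _ Jz.
rewrite z_def in Jz *; apply/mem_line; apply: contrapT => /negP dvdN.
apply: QNJ.
have [x [y xy]] := bezout_prime f_prime dvdN.
have Je1 : J e1.
  apply: (zclosed_bezout J_closed xy).
    have -> : (m' * n - n' * m)%:~R * e1 = n%:~R * (m'%:~R * e1 + n'%:~R * e2)
      + (- n')%:~R * (m%:~R * e1 + n%:~R * e2) by ring.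
    exact: J_closed.
  by apply: fQJ; exists e1 => //; exists 1, 0; ring.
have Je2 : J e2.
  apply: (zclosed_bezout J_closed xy).
    have -> : (m' * n - n' * m)%:~R * e2 =
      (- m)%:~R * (m'%:~R * e1 + n'%:~R * e2)
      + m'%:~R * (m%:~R * e1 + n%:~R * e2) by ring.
    exact: J_closed.
  by apply: fQJ; exists e2 => //; exists 0, 1; ring.
by move=> _ [a [b ->]]; apply: J_closed.
Qed.

Lemma line_eq J m n : zclosed J -> scale q Q `<=` J -> J `<` Q ->
  ~~ ((f %| m)%Z && (f %| n)%Z) -> J (m%:~R * e1 + n%:~R * e2) ->
  J = line m n.
Proof.
move=> J_closed fQJ JQ mnN0 Jmn; apply/seteqP; split.
  exact: sub_line_closed.
exact: line_sub_closed.
Qed.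

Lemma line_proper m n : ~~ ((f %| m)%Z && (f %| n)%Z) -> line m n `<` Q.
Proof.
move=> mnN0; split; first exact: line_sub.
move=> Q_line; case/negP: mnN0; apply/andP; split.
  have /Q_line/mem_line : Q (0%:~R * e1 + 1%:~R * e2) by exists 0, 1.
  by rewrite mul0r mul1r sub0r rpredN.
have /Q_line/mem_line : Q (1%:~R * e1 + 0%:~R * e2) by exists 1, 0.
by rewrite mul0r mul1r subr0.
Qed.

Lemma scaled_proper_line m n :
  ~~ ((f %| m)%Z && (f %| n)%Z) -> scale q Q `<` line m n.
Proof.
move=> mnN0; split; first exact: scaled_sub_line.
by move=> /(_ _ (line_gen m n)) /mem_scaled; apply/negP.
Qed.

Lemma between_line J : zclosed J -> scale q Q `<` J -> J `<` Q ->
  exists m n, ~~ ((f %| m)%Z && (f %| n)%Z) /\ J = line m n.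
Proof.
move=> J_closed [fQJ JNfQ] JQ.
have [z Jz fQNz] : exists2 z, J z & ~ scale q Q z.
  apply: contrapT => noz; apply: JNfQ => z Jz; apply: contrapT => fQNz.
  by apply: noz; exists z.
have [JsQ _] := JQ; have [m [n z_def]] := JsQ _ Jz; rewrite z_def in Jz fQNz.
exists m, n; suff mnN0 : ~~ ((f %| m)%Z && (f %| n)%Z).
  by split=> //; apply: line_eq.
by apply/negP => /mem_scaled.
Qed.

Lemma line_dvd m n : ~~ ((f %| m)%Z && (f %| n)%Z) -> (f %| n)%Z ->
  line m n = line 1 0.
Proof.
move=> mnN0 fn; symmetry; apply: line_eq.
- exact: line_closed.
- exact: scaled_sub_line.
- apply: line_proper; rewrite dvdz0 andbT.
  by have := prime_gt1 f_prime; rewrite dvdzE dvdn1; lia.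
- done.
- by apply/mem_line; rewrite mulr0 sub0r rpredN mulr1.
Qed.

(** The representatives (a, v) have the second coordinate of f alpha modulo
    f Q; a solves a n = v m modulo f. *)
Lemma line_ndvd v m n : ~~ (f %| v)%Z -> ~~ (f %| n)%Z ->
  exists2 a : nat, (a < f)%N & line m n = line a v.
Proof.
move=> fNv fNn; have [x [y xy]] := bezout_prime f_prime fNn.
have f_gt0 : 0 < f%:Z by have := prime_gt0 f_prime; lia.
have fN0 : f%:Z != 0 by rewrite gt_eqF.
have a_ge0 := modz_ge0 (x * v * m) fN0.
exists `|(x * v * m %% f)%Z|%N.
  by have := ltz_pmod (x * v * m) f_gt0; lia.
rewrite gez0_abs//; set a := (_ %% _)%Z.
symmetry; apply: line_eq.
- exact: line_closed.
- exact: scaled_sub_line.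
- by apply: line_proper; rewrite negb_and fNv orbT.
- by rewrite negb_and fNn orbT.
- apply/mem_line.
  have -> : m * v - n * a = f%:Z * (m * v * y + n * (x * v * m %/ f)%Z).
    have a_def : a = x * v * m - (x * v * m %/ f)%Z * f%:Z.
      by apply/esym/eqP; rewrite subr_eq addrC; apply/eqP; apply: divz_eq.
    by rewrite a_def -[X in X - _]mulr1 -xy; ring.
  exact: dvdz_mulr.
Qed.

Lemma line_ndvd_inj (v : int) (a b : nat) : ~~ (f %| v)%Z ->
  (a < f)%N -> (b < f)%N -> line a v = line b v -> a = b.
Proof.
move=> fNv af bf lab; have := line_gen a v; rewrite lab => /mem_line.
rewrite [v * _]mulrC -mulrBl prime_dvdzM// (negbTE fNv) orbF => /dvdzP[c ab].
have [c_le0|c_gt0|c0] := ltrgtP c 0; [nia|nia|].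
by move: ab; rewrite c0 mul0r; lia.
Qed.

Lemma line_neq (v a : int) : ~~ (f %| v)%Z -> line 1 0 <> line a v.
Proof.
move=> fNv lE; have : line 1 0 e1 by apply/mem_line1; rewrite dvdz0.
by rewrite lE => /mem_line1; apply/negP.
Qed.

End Lines.

Arguments mem_line {K f e1 e2} free m n m' n'.
Arguments mem_line1 {K f e1 e2} free m n.

(** * Ideals of a quadratic order *)

Section QuadraticOrders.
Variables (K : fieldType) (x : K) (t n : int).
Hypothesis x2 : x ^+ 2 = t%:~R * x - n%:~R.
Let S := zspan 1 x.

Lemma quadratic_order0 : S 0.
Proof. by exists 0, 0; ring. Qed.

Lemma quadratic_order1 : S 1.
Proof. by exists 1, 0; ring. Qed.

Lemma quadratic_orderM y z : S y -> S z -> S (y * z).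
Proof.
move=> [a [b ->]] [a' [b' ->]].
exists (a * a' - b * b' * n), (a * b' + b * a' + b * b' * t).
have -> : (a%:~R * 1 + b%:~R * x) * (a'%:~R * 1 + b'%:~R * x) =
  (a * a')%:~R + (a * b' + b * a')%:~R * x + (b * b')%:~R * x ^+ 2 by ring.
by rewrite x2; ring.
Qed.

Lemma int_adjoin_quadratic : int_adjoin x = S.
Proof.
apply/seteqP; split=> [_ [p _ <-]|_ [a [b ->]]].
  elim/poly_ind: p => [|p c [a [b IHp]]].
    by rewrite map_poly0 horner0; exists 0, 0; ring.
  rewrite rmorphD rmorphM/= map_polyX map_polyC/= hornerMXaddC IHp.
  exists (c - b * n), (a + b * t).
  have -> : (a%:~R * 1 + b%:~R * x) * x + c%:~R =
    c%:~R + a%:~R * x + b%:~R * x ^+ 2 by ring.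
  by rewrite x2; ring.
exists (b%:P * 'X + a%:P) => //.
by rewrite rmorphD rmorphM/= map_polyX !map_polyC/= hornerMXaddC hornerC; ring.
Qed.

Lemma quadratic_ideal J : J `<=` S -> J 0 -> zclosed J ->
  (forall y, J y -> J (x * y)) -> is_ideal S J.
Proof.
move=> JS J0 J_closed Jx; split=> // [y z Jy Jz|_ y [a [b ->]] Jy].
  exact: zclosedD.
rewrite mulr1 mulrDl -mulrA; apply: zclosedD => //; apply: zclosedZ => //.
exact: Jx.
Qed.

Lemma ideal_zclosed J : is_ideal S J -> zclosed J.
Proof.
move=> [_ _ JD JM] a b y z Jy Jz.
by apply: JD; apply: JM => //; [exists a, 0|exists b, 0]; ring.
Qed.

Lemma ideal2_ideal a b : S a -> S b -> is_ideal S (ideal2 S a b).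
Proof.
have S0 := quadratic_order0.
move=> Sa Sb; split.
- move=> _ [y Sy [z Sz <-]]; apply: zclosedD; first exact: zspan_closed.
    exact: quadratic_orderM.
  exact: quadratic_orderM.
- by exists 0 => //; exists 0 => //; ring.
- move=> _ _ [y Sy [z Sz <-]] [y' Sy' [z' Sz' <-]].
  exists (y + y'); first by apply: zclosedD => //; apply: zspan_closed.
  exists (z + z'); first by apply: zclosedD => //; apply: zspan_closed.
  by ring.
- move=> c _ Sc [y Sy [z Sz <-]].
  exists (c * y); first exact: quadratic_orderM.
  exists (c * z); first exact: quadratic_orderM.
  by ring.
Qed.

Lemma ideal2_l a b : ideal2 S a b a.
Proof.
exists 1; first exact: quadratic_order1.
by exists 0; [exact: quadratic_order0|ring].
Qed.

Lemma ideal2_r a b : ideal2 S a b b.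
Proof.
exists 0; first exact: quadratic_order0.
by exists 1; [exact: quadratic_order1|ring].
Qed.

Lemma ideal2_min a b I : is_ideal S I -> I a -> I b -> ideal2 S a b `<=` I.
Proof.
move=> [_ _ ID IM] Ia Ib _ [y Sy [z Sz <-]].
by apply: ID; rewrite mulrC; apply: IM.
Qed.

Lemma ideal_gen_ideal G : G `<=` S -> is_ideal S (ideal_gen S G).
Proof.
move=> GS; split.
- move=> y /(_ S); apply; split=> //; apply: quadratic_ideal => //.
  + exact: quadratic_order0.
  + exact: zspan_closed.
  + by move=> z Sz; apply: quadratic_orderM => //; exists 0, 1; ring.
- by move=> I [[]].
- move=> y z Gy Gz I IG; have [[_ _ ID _] _] := IG.
  by apply: ID; [apply: Gy|apply: Gz].
- move=> a y Sa Gy I IG; have [[_ _ _ IM] _] := IG.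
  by apply: IM => //; apply: Gy.
Qed.

Lemma sub_ideal_gen G : G `<=` ideal_gen S G.
Proof. by move=> y Gy I [_]; apply. Qed.

Lemma ideal_gen_min G I : is_ideal S I -> G `<=` I -> ideal_gen S G `<=` I.
Proof. by move=> I_ideal GI y; apply. Qed.

(** As S = Z + Z (a + x), every coset of I contains an integer, which can be
    reduced modulo m. *)
Lemma norm_le_nat I M (m : nat) (a : int) : is_ideal S I -> norm_is S I M ->
  (0 < m)%N -> I m%:R -> I (a%:~R + x) -> (M <= m)%N.
Proof.
move=> I_ideal normI m_gt0 Im Iax; rewrite -card_le_II.
have I_closed := ideal_zclosed I_ideal.
rewrite -(card_le_eql normI).
apply: card_le_trans (card_image_le (fun i : nat => [set i%:R + y | y in I]) _).
apply: subset_card_le => _ [_ [b [c ->]] <-].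
have mN0 : m%:Z != 0 by lia.
pose r := ((b - c * a) %% m)%Z.
have r_ge0 : 0 <= r by exact: modz_ge0.
exists `|r|%N => /=.
  by have := ltz_pmod (b - c * a) (_ : 0 < m%:Z); rewrite -/r; lia.
have rE : `|r|%:R = r%:~R :> K by rewrite pmulrn gez0_abs.
suff Idiff : I (b%:~R * 1 + c%:~R * x - r%:~R).
  apply/seteqP; split=> _ [y Iy <-]; rewrite rE.
    exists (y - (b%:~R * 1 + c%:~R * x - r%:~R)); last by ring.
    exact: zclosedB.
  exists (y + (b%:~R * 1 + c%:~R * x - r%:~R)); last by ring.
  exact: zclosedD.
have -> : b%:~R * 1 + c%:~R * x - r%:~R =
    ((b - c * a) %/ m)%Z%:~R * m%:R + c%:~R * (a%:~R + x).
  have bE : b = ((b - c * a) %/ m)%Z * m + r + c * a.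
    by rewrite -divz_eq; ring.
  by rewrite {1}bE; ring.
exact: I_closed.
Qed.

End QuadraticOrders.

(** * Ideals between Q and fQ *)

Section BasicIdeals.
Variables (K : fieldType) (w : K) (t n : int) (f : nat) (u : int) (j : nat).
Hypothesis w2 : w ^+ 2 = t%:~R * w - n%:~R.
Hypothesis free_w : forall a b : int,
  a%:~R * 1 + b%:~R * w = 0 -> a = 0 /\ b = 0.
Hypothesis f_prime : prime f.

Let q : K := f%:R.
Let g : int := f%:Z ^+ j.
Let G : int := f%:Z ^+ j.+1.
Let e1 : K := G%:~R.
Let e2 : K := q * (u%:~R + w).
Let D := zspan 1 w.
Let O := zspan 1 (q * w).
Let Q := zspan e1 e2.

Let f_neq0 : f%:Z != 0.
Proof. by have := prime_gt0 f_prime; lia. Qed.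

Let G_neq0 : G != 0.
Proof. exact: expf_neq0. Qed.

Let GE : G = f%:Z * g.
Proof. exact: exprS. Qed.

Lemma conductor_generator_quadratic :
  (q * w) ^+ 2 = (f%:Z * t)%:~R * (q * w) - (f%:Z ^+ 2 * n)%:~R.
Proof. by rewrite exprMn w2 /q; ring. Qed.
Let theta2 := conductor_generator_quadratic.

Lemma order_sub : O `<=` D.
Proof. by move=> _ [a [b ->]]; exists a, (b * f%:Z); rewrite /q; ring. Qed.

Lemma basis_free (a b : int) : a%:~R * e1 + b%:~R * e2 = 0 -> a = 0 /\ b = 0.
Proof.
move=> ab0; have [] := @free_w (a * G + b * f%:Z * u) (b * f%:Z).
  by rewrite -[RHS]ab0 /e1 /e2 /q; ring.
move=> abE /eqP; rewrite mulf_eq0 (negbTE f_neq0) orbF => /eqP b0.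
move: abE; rewrite b0 !mul0r addr0 => /eqP.
by rewrite mulf_eq0 (negbTE G_neq0) orbF => /eqP.
Qed.

Lemma w_e1 : w * e1 = g%:~R * e2 - u%:~R * e1.
Proof. by rewrite /e1 GE /e2 /q; ring. Qed.

Lemma span_sub_order : Q `<=` O.
Proof.
move=> _ [a [b ->]]; exists (a * G + b * f%:Z * u), b.
by rewrite /e1 /e2 /q; ring.
Qed.

Lemma span_int (a : int) : Q a%:~R -> (G %| a)%Z.
Proof.
move=> [m [l aE]]; have [] := @free_w (m * G + l * f%:Z * u - a) (l * f%:Z).
  rewrite -[RHS](subrr a%:~R) [X in _ = X - _]aE /e1 /e2 /q; ring.
move=> maE /eqP; rewrite mulf_eq0 (negbTE f_neq0) orbF => /eqP l0.
by apply/dvdzP; exists m; move: maE; rewrite l0 !mul0r addr0 => /subr0_eq.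
Qed.

(** The norm of u + w. *)
Let N : int := u ^+ 2 + t * u + n.

Lemma w_e2 : w * e2 = (u + t)%:~R * e2 - (f%:Z * N)%:~R.
Proof.
have -> : w * e2 = q * u%:~R * w + q * w ^+ 2 by rewrite /e2; ring.
by rewrite w2 /e2 /N /q; ring.
Qed.

Section Between.
Variable c : int.
Hypothesis c_def : c * G = f%:Z ^+ 2 * N.

(** Modulo f Q, the generator f w of O kills e1 and sends e2 to - c e1. *)
Lemma theta_span (a b : int) : q * w * (a%:~R * e1 + b%:~R * e2) =
  (- (f%:Z * u * a) - c * b)%:~R * e1 + (f%:Z * (g * a + (u + t) * b))%:~R * e2.
Proof.
have cK : c%:~R * e1 = q ^+ 2 * N%:~R :> K.
  by rewrite /e1 -intrM c_def /q; ring.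
have -> : q * w * (a%:~R * e1 + b%:~R * e2) =
  q * a%:~R * (w * e1) + q * b%:~R * (w * e2) by ring.
rewrite w_e1 w_e2.
have -> : (- (f%:Z * u * a) - c * b)%:~R * e1 =
  (- (f%:Z * u * a))%:~R * e1 - b%:~R * (c%:~R * e1) by ring.
by rewrite cK /q; ring.
Qed.

Lemma line_ideal (m l : int) : (f %| c * l)%Z -> is_ideal O (line f e1 e2 m l).
Proof.
move=> /dvdzP[r clE]; apply: (quadratic_ideal).
- by move=> z /line_sub; apply: span_sub_order.
- by exists 0, 0; split; [ring|rewrite !mul0r subrr dvdz0].
- exact: line_closed.
move=> _ [a [b [-> /dvdzP[s abE]]]]; rewrite theta_span.
apply/(mem_line basis_free).
have -> : (- (f%:Z * u * a) - c * b) * l - f%:Z * (g * a + (u + t) * b) * m =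
  f%:Z * (- (u * a) * l - (g * a + (u + t) * b) * m) - b * (c * l) by ring.
by rewrite clE mulrA; apply: rpredB; [apply: dvdz_mulr|apply: dvdz_mull].
Qed.

(** Stability of the line of m e1 + l e2 amounts to f | c l^2, since f w sends
    this vector to - c l e1 modulo f Q. *)
Lemma between_lineP J : ideals_between O q Q J <->
  exists m l : int, [/\ ~~ ((f %| m)%Z && (f %| l)%Z), (f %| c * l)%Z
                      & J = line f e1 e2 m l].
Proof.
split=> [[J_ideal fQJ JQ]|[m [l [mlN0 cl ->]]]].
  have J_closed := ideal_zclosed J_ideal.
  have [m [l [mlN0 JE]]] := between_line f_prime basis_free J_closed fQJ JQ.
  exists m, l; split=> //.
  have Jml : J (m%:~R * e1 + l%:~R * e2).
    by rewrite JE; apply: (line_gen f basis_free).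
  have : J (q * w * (m%:~R * e1 + l%:~R * e2)).
    by have [_ _ _] := J_ideal; apply => //; exists 0, 1; ring.
  rewrite theta_span JE => /(mem_line basis_free).
  have -> : (- (f%:Z * u * m) - c * l) * l - f%:Z * (g * m + (u + t) * l) * m =
    - (l * (c * l)) - f%:Z * (u * m * l + (g * m + (u + t) * l) * m) by ring.
  rewrite -opprD rpredN rpredDr; last exact: dvdz_mulr.
  move=> flcl.
  have /orP[fl|//] : (f %| l)%Z || (f %| c * l)%Z by rewrite -prime_dvdzM.
  exact: dvdz_mull.
split; first exact: line_ideal.
  exact: (scaled_proper_line basis_free).
exact: (line_proper basis_free).
Qed.

Lemma ideal_line_eq I (m l : int) : ~~ ((f %| m)%Z && (f %| l)%Z) ->
  is_ideal O I -> I `<=` line f e1 e2 m l -> I (m%:~R * e1 + l%:~R * e2) ->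
  I (q * e1) -> I (q * e2) -> I = line f e1 e2 m l.
Proof.
move=> mlN0 I_ideal IL Iml Ie1 Ie2; apply/seteqP; split=> //.
have I_closed := ideal_zclosed I_ideal.
apply: line_sub_closed => // _ [_ [a [b ->]] <-].
have -> : q * (a%:~R * e1 + b%:~R * e2) = a%:~R * (q * e1) + b%:~R * (q * e2).
  by ring.
exact: I_closed.
Qed.

(* The original generator f alpha of Q, in the basis e1, e2: it agrees with a
   unit multiple of e2 modulo f Q. *)
Section Generators.
Variables (v r : int).
Hypothesis fNv : ~~ (f %| v)%Z.

Let qalpha := v%:~R * e2 + (r * f%:Z)%:~R * e1.

Let fN1 : ~~ (f %| 1)%Z.
Proof. by have := prime_gt1 f_prime; rewrite dvdzE dvdn1; lia. Qed.

(** The ideal contains v (f e2) and, through f w e1, also f^(k-1) (f e2);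
    these coefficients are coprime, so it contains f Q. *)
Lemma ideal2_line10 : ideal2 O e1 (q * qalpha) = line f e1 e2 1 0.
Proof.
have Oe1 : O e1 by apply: span_sub_order; exists 1, 0; ring.
have qaE : q * qalpha = (r * f%:Z ^+ 2)%:~R * e1 + (v * f%:Z)%:~R * e2.
  by rewrite /qalpha /q; ring.
have Oqa : O (q * qalpha).
  by rewrite qaE; apply: span_sub_order; exists (r * f%:Z ^+ 2), (v * f%:Z).
have I_ideal := ideal2_ideal theta2 Oe1 Oqa.
have I_closed := ideal_zclosed I_ideal.
have Ie1 := ideal2_l (q * w) e1 (q * qalpha).
have Iqa := ideal2_r (q * w) e1 (q * qalpha).
apply: ideal_line_eq => //.
- by rewrite negb_and fN1.
- apply: ideal2_min.
  + by apply: line_ideal; rewrite mulr0 dvdz0.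
  + by apply/(mem_line1 basis_free); rewrite dvdz0.
  + rewrite qaE; apply/(mem_line basis_free).
    by rewrite mulr0 sub0r rpredN mulr1 dvdz_mull.
- by rewrite mul1r mul0r addr0.
- exact: (zclosedZ f I_closed).
have [x [y xy]] := bezout_prime_power j f_prime fNv.
apply: (zclosed_bezout I_closed xy).
  have -> : v%:~R * (q * e2) =
    1%:~R * (q * qalpha) + (- (r * f%:Z ^+ 2))%:~R * e1 by rewrite qaE /q; ring.
  exact: I_closed.
have -> : (f%:Z ^+ j)%:~R * (q * e2) =
    1%:~R * (q * w * e1) + (f%:Z * u)%:~R * e1.
  by rewrite -mulrA w_e1 /g /q; ring.
apply: I_closed => //; have [_ _ _] := I_ideal; apply => //.
by exists 0, 1; ring.
Qed.

(** As for [ideal2_line10], with f^k (f e2) obtained from f w (f e1). As f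
    does not divide v, this line is an ideal only when f divides c. *)
Lemma ideal2_line (a : nat) : (f %| c)%Z ->
  ideal2 O (q * e1) (a%:R * e1 + qalpha) = line f e1 e2 a v.
Proof.
move=> fc; set x := a%:R * e1 + qalpha.
have xE : x = (a%:Z + r * f%:Z)%:~R * e1 + v%:~R * e2.
  by rewrite /x /qalpha; ring.
have Oqe1 : O (q * e1).
  by apply: span_sub_order; exists f, 0; rewrite /q; ring.
have Ox : O x.
  by rewrite xE; apply: span_sub_order; exists (a%:Z + r * f%:Z), v.
have I_ideal := ideal2_ideal theta2 Oqe1 Ox.
have I_closed := ideal_zclosed I_ideal.
have Iqe1 := ideal2_l (q * w) (q * e1) x.
have Ix := ideal2_r (q * w) (q * e1) x.
apply: ideal_line_eq => //.
- by rewrite negb_and fNv orbT.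
- apply: ideal2_min.
  + by apply: line_ideal; apply: dvdz_mulr.
  + apply: scaled_sub_line; exists e1 => //.
    by exists 1, 0; ring.
  + rewrite xE; apply/(mem_line basis_free).
    have -> : (a%:Z + r * f%:Z) * v - v * a = r * v * f%:Z by ring.
    exact: dvdz_mull.
- have -> : a%:~R * e1 + v%:~R * e2 = 1%:~R * x + (- r)%:~R * (q * e1).
    by rewrite xE /q; ring.
  exact: I_closed.
have [y [z yz]] := bezout_prime_power j.+1 f_prime fNv.
apply: (zclosed_bezout I_closed yz).
  have -> : v%:~R * (q * e2) =
    f%:~R * x + (- (a%:Z + r * f%:Z))%:~R * (q * e1) by rewrite xE /q; ring.
  exact: I_closed.
rewrite -/G.
have -> : G%:~R * (q * e2) =
    1%:~R * (q * w * (q * e1)) + (f%:Z * u)%:~R * (q * e1).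
  have -> : q * w * (q * e1) = q ^+ 2 * (w * e1) by ring.
  by rewrite w_e1 GE /q; ring.
apply: I_closed => //; have [_ _ _] := I_ideal; apply => //.
by exists 0, 1; ring.
Qed.

End Generators.

Let QD := ideal_gen D Q.

Let span_sub_D : Q `<=` D.
Proof. by move=> z /span_sub_order; apply: order_sub. Qed.

(** Only w e2 can leave Q, and it differs from an element of Q by f N, an
    integer; the integers of Q are the multiples of f^k. *)
Lemma span_dmodule : QD = Q <-> (f %| c)%Z.
Proof.
split=> [QDE|/dvdzP[c' cE]].
  have [_ _ _ /(_ w e2)] := ideal_gen_ideal w2 span_sub_D.
  rewrite -/QD QDE w_e2 => /(_ _ _)[].
  - by exists 0, 1; ring.
  - by exists 0, 1; ring.
  move=> a [b wE].
  have : Q (f%:Z * N)%:~R.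
    exists (- a), (u + t - b).
    have -> : (f%:Z * N)%:~R = (u + t)%:~R * e2 - (a%:~R * e1 + b%:~R * e2).
      by rewrite -wE; ring.
    by ring.
  move=> /span_int/dvdzP[c' c'E]; apply/dvdzP; exists c'.
  by apply: (mulIf G_neq0); rewrite c_def expr2 -mulrA c'E; ring.
have NE : f%:Z * N = c' * G.
  by apply: (mulfI f_neq0); rewrite mulrA -expr2 -c_def cE; ring.
apply/seteqP; split; last exact: sub_ideal_gen.
apply: ideal_gen_min => //; apply: (quadratic_ideal) => //.
- by exists 0, 0; ring.
- exact: zspan_closed.
move=> _ [a [b ->]].
have -> : w * (a%:~R * e1 + b%:~R * e2) = a%:~R * (w * e1) + b%:~R * (w * e2).
  by ring.
rewrite w_e1 w_e2 NE.
exists (- (a * u) - b * c'), (a * g + b * (u + t)).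
by rewrite /e1; ring.
Qed.

(** QD is Z f^(k-1) + Z e2: it contains f^k and f N = c f^(k-1) with c prime
    to f. That f does not divide c forces k >= 2, which is what makes this group
    stable under w. *)
Lemma line10_scaled : ~~ (f %| c)%Z -> line f e1 e2 1 0 = scale q QD.
Proof.
move=> fNc.
have QD_ideal := ideal_gen_ideal w2 span_sub_D; rewrite -/QD in QD_ideal.
have QD_closed := ideal_zclosed QD_ideal.
have Qe1 : Q e1 by exists 1, 0; ring.
have Qe2 : Q e2 by exists 0, 1; ring.
have NE : f%:Z * N = c * g.
  by apply: (mulfI f_neq0); rewrite mulrA -expr2 -c_def GE; ring.
(* If k = 1, then c = f N. *)
have [g' gE] : exists g', g = f%:Z * g'.
  move: NE; rewrite /g.
  case: j => [|j' _]; last by exists (f%:Z ^+ j'); rewrite exprS.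
  rewrite expr0 mulr1 => NE; case/negP: fNc.
  by rewrite -NE dvdz_mulr.
apply/seteqP; split=> [_ [a [b [-> ]]]|].
  rewrite mulr0 sub0r rpredN mulr1 => /dvdzP[b' ->].
  exists (a%:~R * g%:~R + b'%:~R * e2); last by rewrite /e1 GE /q; ring.
  apply: (QD_closed); last exact: sub_ideal_gen.
  have [x [y xy]] := bezout_prime f_prime fNc.
  apply: (zclosed_bezout QD_closed xy).
    have -> : c%:~R * g%:~R = (u + t)%:~R * e2 + (-1)%:~R * (w * e2).
      by rewrite w_e2 NE; ring.
    apply: (QD_closed); first exact: sub_ideal_gen.
    have [_ _ _] := QD_ideal; apply; last exact: sub_ideal_gen.
    by exists 0, 1; ring.
  have -> : f%:Z%:~R * g%:~R = e1 by rewrite /e1 GE; ring.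
  exact: sub_ideal_gen.
have QDg : QD `<=` zspan g%:~R e2.
  apply: ideal_gen_min.
    apply: quadratic_ideal.
    - move=> _ [a [b ->]]; exists (a * g + b * f%:Z * u), (b * f%:Z).
      by rewrite /e2 /q; ring.
    - by exists 0, 0; ring.
    - exact: zspan_closed.
    move=> _ [a [b ->]]; exists (- (a * u) - b * c), (a * g' + b * (u + t)).
    have -> : w * (a%:~R * g%:~R + b%:~R * e2) =
      a%:~R * (w * g%:~R) + b%:~R * (w * e2) by ring.
    have -> : w * g%:~R = g'%:~R * e2 - u%:~R * g%:~R.
      by rewrite gE /e2 /q; ring.
    by rewrite w_e2 NE; ring.
  by move=> _ [a [b ->]]; exists (a * f%:Z), b; rewrite /e1 GE; ring.
move=> _ [z /QDg[a [b ->]] <-]; exists a, (f%:Z * b); split.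
  by rewrite /e1 GE /q; ring.
by rewrite mulr0 sub0r rpredN mulr1 dvdz_mulr.
Qed.

End Between.

Lemma span_norm_dvd : is_ideal O Q -> exists c : int, c * G = f%:Z ^+ 2 * N.
Proof.
move=> Q_ideal; suff : Q (f%:Z ^+ 2 * N)%:~R.
  by move=> /span_int/dvdzP[c ->]; exists c.
have Q_closed := ideal_zclosed Q_ideal.
have Qe2 : Q e2 by exists 0, 1; ring.
have -> : (f%:Z ^+ 2 * N)%:~R =
    (f%:Z * (u + t))%:~R * e2 + (-1)%:~R * (q * w * e2).
  by rewrite -mulrA w_e2 /q; ring.
apply: Q_closed => //; have [_ _ _] := Q_ideal; apply => //.
by exists 0, 1; ring.
Qed.

(** * Powers of the conductor *)

Let F := conductor O D.

(** Comparing coefficients of w in w (a + b f w) shows that f divides a. *)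
Lemma conductor_sub : F `<=` scale q D.
Proof.
move=> z [[a [b ->]] /(_ w)[]]; first by exists 0, 1; ring.
move=> a' [b' wE].
have [] := @free_w (- (b * f%:Z * n) - a') (a + b * f%:Z * t - b' * f%:Z).
  apply: etrans (_ : q * b%:~R * w ^+ 2 + a%:~R * w
                     - (a'%:~R * 1 + b'%:~R * (q * w)) = _).
    by rewrite w2 /q; ring.
  by rewrite -wE; ring.
move=> _ aE; exists ((b' - b * t)%:~R * 1 + b%:~R * w).
  by exists (b' - b * t), b.
have -> : a = f%:Z * (b' - b * t) by lia.
by rewrite /q; ring.
Qed.

Lemma conductor_f : F q.
Proof.
split=> [|_ [a [b ->]]]; first by exists f, 0; rewrite /q; ring.
by exists (f%:Z * a), b; rewrite /q; ring.
Qed.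

Lemma conductor_pow_f i : ideal_pow O F i (q ^+ i).
Proof.
elim: i => [|i IHi]; first by rewrite expr0; exact: quadratic_order1.
exists 1%N, (fun=> q), (fun=> q ^+ i); split; last by rewrite big_ord1 exprS.
by split=> //; apply: conductor_f.
Qed.

Lemma conductor_pow_sub i : ideal_pow O F i `<=` scale (q ^+ i) D.
Proof.
elim: i => [z Oz|i IHi _ [l [x [y [xy ->]]]]].
  by exists z; [apply: order_sub|rewrite mul1r].
pose S := scale (q ^+ i.+1) D.
have SD a b : S a -> S b -> S (a + b).
  move=> [a' Da' <-] [b' Db' <-]; exists (a' + b'); last by rewrite mulrDr.
  by apply: (zclosedD _ Da' Db'); apply: zspan_closed.
have S0 : S 0 by exists 0; [exact: quadratic_order0|rewrite mulr0].
apply: (big_ind S) => // k _.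
have [/conductor_sub[x' Dx' <-] /IHi[y' Dy' <-]] := xy k.
exists (x' * y'); first exact: (quadratic_orderM w2).
by rewrite exprS; ring.
Qed.

Lemma conductor_pow_span : ideal_pow O F j.+1 `<=` Q.
Proof.
move=> z /conductor_pow_sub[_ [a [b ->]] <-].
exists (a - b * u), (b * g).
have -> : q ^+ j.+1 = e1 by rewrite /e1 /G rmorphXn.
have -> : e1 * (a%:~R * 1 + b%:~R * w) = a%:~R * e1 + b%:~R * (w * e1) by ring.
by rewrite w_e1; ring.
Qed.

Lemma conductor_pow_min i : ideal_pow O F i `<=` Q -> (j.+1 <= i)%N.
Proof.
move=> /(_ _ (conductor_pow_f i)).
have -> : q ^+ i = (f%:Z ^+ i)%:~R by rewrite rmorphXn.
move=> /span_int; rewrite /G dvdzE !abszX.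
by rewrite dvdn_Pexp2l// prime_gt1.
Qed.

End BasicIdeals.

(** * The normal form of a basic ideal *)

(** With x v + y f^k = 1, the element e2 = x (f alpha) + y (f w) f^k of Q is
    f (x a + w), where alpha = a + v w. An element of Q is, up
    to a multiple of e2, an integer of Q; its remainder modulo f^k is an integer
    of Q below the norm f^k, hence 0 by [norm_le_nat]. *)
Lemma basic_ideal_basis (K : fieldType) (w : K) (t n : int) (f j : nat)
    (alpha : K) (Q : set K) :
  let O := zspan 1 (f%:R * w) in
  let e1 := (f%:Z ^+ j.+1)%:~R : K in
  w ^+ 2 = t%:~R * w - n%:~R -> prime f -> zspan 1 w alpha -> ~ O alpha ->
  Q = ideal2 O (f%:R ^+ j.+1) (f%:R * alpha) ->
  norm_is O Q (f ^ j.+1)%N ->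
  exists u v r : int, let e2 := f%:R * (u%:~R + w) in
    [/\ ~~ (f %| v)%Z, is_ideal O Q, Q = zspan e1 e2
      & f%:R * alpha = v%:~R * e2 + (r * f%:Z)%:~R * e1].
Proof.
move=> O e1 w2 f_prime [a [v alphaE]] ONalpha QE normQ.
have theta2 := conductor_generator_quadratic f w2.
have e1E : f%:R ^+ j.+1 = e1 by rewrite /e1 rmorphXn.
rewrite e1E in QE.
have fNv : ~~ (f %| v)%Z.
  apply/negP => /dvdzP[b vE]; apply: ONalpha; exists a, b.
  by rewrite alphaE vE; ring.
have [x [y xy]] := bezout_prime_power j.+1 f_prime fNv.
have xyK : x%:~R * v%:~R + y%:~R * e1 = 1 :> K by rewrite -!intrM -intrD xy.
pose e2 : K := f%:R * ((x * a)%:~R + w).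
have Q_ideal : is_ideal O Q.
  rewrite QE; apply: (ideal2_ideal theta2).
    by exists (f%:Z ^+ j.+1), 0; rewrite /e1; ring.
  by exists (f%:Z * a), v; rewrite alphaE; ring.
have Q_closed := ideal_zclosed Q_ideal.
have Qe1 : Q e1 by rewrite QE; apply: ideal2_l.
have Qfa : Q (f%:R * alpha) by rewrite QE; apply: ideal2_r.
have Qe2 : Q e2.
  have -> : e2 = x%:~R * (f%:R * alpha) + y%:~R * (f%:R * w * e1).
    have wE : w = (x%:~R * v%:~R + y%:~R * e1) * w by rewrite xyK mul1r.
    by rewrite /e2 alphaE [X in _ * (_ + X) = _]wE; ring.
  apply: (Q_closed) => //; have [_ _ _] := Q_ideal; apply => //.
  by exists 0, 1; ring.
exists (x * a), v, (a * y); split=> //; last first.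
  rewrite -/e2 alphaE /e2.
  have -> : v%:~R * (f%:R * ((x * a)%:~R + w)) + (a * y * f%:Z)%:~R * e1 =
    f%:R * (a%:~R * (x%:~R * v%:~R + y%:~R * e1) + v%:~R * w) by ring.
  by rewrite xyK.
apply/seteqP; split; last first.
  by move=> _ [b [c ->]]; apply: Q_closed.
move=> z Qz; have [QO _ _ _] := Q_ideal; have [b [c zE]] := QO _ Qz.
set G := f%:Z ^+ j.+1; pose b' := b - c * (f%:Z * (x * a)).
suff /dvdzP[b'' b'E] : (G %| b')%Z.
  exists b'', c; rewrite -/e2 zE.
  have -> : b = b'' * G + c * (f%:Z * (x * a)) by rewrite -b'E /b'; ring.
  by rewrite /e1 -/G /e2; ring.
have G_gt0 : 0 < G by rewrite exprn_gt0//; have := prime_gt0 f_prime; lia.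
have Qb' : Q b'%:~R.
  have -> : b'%:~R = 1%:~R * z + (- c)%:~R * e2 by rewrite zE /b' /e2; ring.
  exact: Q_closed.
apply/dvdz_mod0P; apply: contrapT => r_neq0.
pose r := (b' %% G)%Z; have r_ge0 : 0 <= r by rewrite modz_ge0 ?gt_eqF.
have r_lt : r < G by apply: ltz_pmod.
have Qr : Q `|r|%N%:R.
  rewrite pmulrn gez0_abs//.
  have -> : r%:~R = 1%:~R * b'%:~R + (- (b' %/ G)%Z)%:~R * e1 :> K.
    by rewrite [b' in X in X + _](divz_eq b' G) -/r /e1 -/G; ring.
  exact: Q_closed.
have r_gt0 : (0 < `|r|)%N by move: r_neq0; rewrite -/r; lia.
have : (f ^ j.+1 <= `|r|)%N.
  apply: (norm_le_nat (a := f%:Z * (x * a)) Q_ideal normQ r_gt0 Qr).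
  suff <- : e2 = (f%:Z * (x * a))%:~R + f%:R * w by [].
  by rewrite /e2; ring.
have -> : (f ^ j.+1)%N = `|G|%N by rewrite /G abszX.
by lia.
Qed.

(** * The ring of integers of a quadratic field *)

Section QuadraticFields.
Variables (d : int) (K : fieldExtType rat) (s : K).
Hypothesis d_sqf : squarefree d.
Hypothesis d_neq1 : d <> 1.
Hypothesis s2 : s ^+ 2 = d%:~R.

Let intK_inj (a b : int) : a%:~R = b%:~R :> K -> a = b.
Proof.
move=> ab; have : (a%:~R : rat)%:A = (b%:~R : rat)%:A :> K.
  by rewrite -!in_algE !rmorph_int.
by rewrite -!in_algE => /fmorph_inj/intr_inj.
Qed.

(** If b <> 0, then a^2 = b^2 d makes d a square, and 1 is the only
    square-free square. *)
Lemma sqrt_free (a b : int) : a%:~R + b%:~R * s = 0 -> a = 0 /\ b = 0.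
Proof.
move=> ab0; suff b0 : b = 0.
  by split=> //; apply: intK_inj; rewrite -[RHS]ab0 b0; ring.
have sq_ab : a ^+ 2 = b ^+ 2 * d.
  apply: intK_inj; have -> : (b ^+ 2 * d)%:~R = (b%:~R * s) ^+ 2.
    by rewrite exprMn s2; ring.
  have -> : b%:~R * s = (a%:~R + b%:~R * s) - a%:~R by ring.
  by rewrite ab0; ring.
apply: contrapT => /eqP bN0.
have /dvdzP[c aE] : (b %| a)%Z.
  rewrite dvdzE -(dvdn_pexp2r _ _ (isT : 0 < 2)%N) -!abszX -dvdzE sq_ab.
  exact: dvdz_mulr.
have dE : d = c ^+ 2.
  have b2N0 : b ^+ 2 != 0 by rewrite expf_neq0.
  by apply: (mulfI b2N0); rewrite -sq_ab aE; ring.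
have : `|c| = 1 by apply: d_sqf; rewrite dE.
move=> c1; apply: d_neq1.
by rewrite dE -[c ^+ 2]ger0_norm ?sqr_ge0// normrX c1 expr1n.
Qed.

Let two_neq0 : 2%:R != 0 :> K.
Proof. by apply/eqP => /(intK_inj (a := 2) (b := 0)). Qed.

Lemma quad_omega_quadratic : exists t n : int,
  quad_omega d s ^+ 2 = t%:~R * quad_omega d s - n%:~R.
Proof.
rewrite /quad_omega; case: eqP => [d1|_]; last first.
  by exists 0, (- d); rewrite s2; ring.
exists 1, (- (d %/ 4)%Z).
have four_neq0 : 4%:R != 0 :> K.
  by apply/eqP => /(intK_inj (a := 4) (b := 0)).
have dE := divz_eq d 4; rewrite d1 in dE.
have sE : s ^+ 2 = 4%:R * (d %/ 4)%Z%:~R + 1 by rewrite s2 {1}dE; ring.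
have -> : ((1 + s) / 2%:R) ^+ 2 = (1 + 2%:R * s + s ^+ 2) / 4%:R.
  by field; rewrite two_neq0 four_neq0.
by rewrite sE; field; rewrite two_neq0 four_neq0.
Qed.

Lemma quad_omega_free (a b : int) :
  a%:~R * 1 + b%:~R * quad_omega d s = 0 -> a = 0 /\ b = 0.
Proof.
rewrite /quad_omega; case: eqP => [_|_] ab0; last first.
  by apply: sqrt_free; rewrite -[RHS]ab0 mulr1.
have [] : 2 * a + b = 0 /\ b = 0; last by lia.
apply: sqrt_free; rewrite -[RHS](mulr0 2%:R) -ab0; field; exact: two_neq0.
Qed.

End QuadraticFields.

(** * Basic ideals and the ideals below them *)

Theorem theorem3p3 (d : int) (d_sqf : squarefree d) (d_neq1 : d <> 1)
    (K : fieldExtType rat) (s : K) (s2 : s ^+ 2 = d%:~R)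
    (K_gen : <<1%VS; s>>%VS = fullv)
    (f : nat) (f_prime : prime f) :
  let w : K := quad_omega d s in
  let D : set K := int_adjoin w in
  let O : set K := int_adjoin (f%:R * w) in
  let F : set K := conductor O D in
  forall (Q : set K) (k : nat) (alpha : K),
  D alpha -> ~ O alpha ->
  Q = ideal2 O (f%:R ^+ k) (f%:R * alpha) ->
  norm_is O Q (f ^ k)%N ->
  is_basic_for O F Q ->
  Q <> scale f%:R O ->
  let QD : set K := ideal_gen D Q in
  let J : set K := ideal2 O (f%:R ^+ k) (f%:R ^+ 2 * alpha) in
  let Ja (a : nat) : set K :=
    ideal2 O (f%:R ^+ k.+1) (a%:R * f%:R ^+ k + f%:R * alpha) in
  [/\ ideal_pow O F k `<=` Q /\
        (forall n : nat, ideal_pow O F n `<=` Q -> (k <= n)%N),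
      QD = Q ->
        [/\ ideals_between O f%:R Q #= `I_f.+1,
            ideals_between O f%:R Q = J |` [set Ja a | a in `I_f],
            forall a : nat, (a < f)%N -> J <> Ja a
          & forall a b : nat, (a < f)%N -> (b < f)%N -> Ja a = Ja b -> a = b]
    & Q <> QD ->
        ideals_between O f%:R Q = [set J] /\ J = scale f%:R QD].
Proof.
move=> w D O F Q k alpha Dalpha ONalpha QE normQ [[[Q_ideal QNO _] _] _] _.
move=> QD J Ja.
have [t [n w2]] := quad_omega_quadratic s2; rewrite -/w in w2.
have free_w := quad_omega_free d_sqf d_neq1 s2; rewrite -/w in free_w.
have DE : D = zspan 1 w := int_adjoin_quadratic w2.
have OE : O = zspan 1 (f%:R * w) :=
  int_adjoin_quadratic (conductor_generator_quadratic f w2).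
rewrite {}/QD {}/J {}/Ja {}/F.
move: D O DE OE Dalpha ONalpha QE normQ Q_ideal QNO => _ _ -> -> Dalpha ONalpha.
move=> QE normQ Q_ideal QNO.
(* If k = 0, then Q contains 1, but a primary ideal is proper. *)
have k_gt0 : (0 < k)%N.
  case: k QE {normQ} => // QE; case: QNO; apply/seteqP; split.
    by case: Q_ideal.
  move=> z Oz; have [_ _ _ QM] := Q_ideal; rewrite -[z]mulr1; apply: QM => //.
  by rewrite QE expr0; apply: ideal2_l.
case: k k_gt0 QE normQ => // j _ QE normQ.
have [u [v [r [fNv _ {}QE alphaE]]]] :=
  basic_ideal_basis w2 f_prime Dalpha ONalpha QE normQ.
rewrite QE in Q_ideal *.
have [c c_def] := span_norm_dvd w2 free_w f_prime Q_ideal.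
have e1E : f%:R ^+ j.+1 = (f%:Z ^+ j.+1)%:~R :> K by rewrite rmorphXn.
have JE : ideal2 (zspan 1 (f%:R * w)) (f%:R ^+ j.+1) (f%:R ^+ 2 * alpha) =
    line f (f%:Z ^+ j.+1)%:~R (f%:R * (u%:~R + w)) 1 0.
  rewrite expr2 -mulrA alphaE e1E.
  exact: (ideal2_line10 w2 free_w f_prime c_def).
have JaE (a : nat) : (f %| c)%Z ->
    ideal2 (zspan 1 (f%:R * w)) (f%:R ^+ j.+2)
      (a%:R * f%:R ^+ j.+1 + f%:R * alpha) =
    line f (f%:Z ^+ j.+1)%:~R (f%:R * (u%:~R + w)) a v.
  move=> fc; rewrite exprS alphaE e1E.
  exact: (ideal2_line w2 free_w f_prime c_def).
have free_e := basis_free (j := j) (u := u) free_w f_prime.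
have fN1 : ~~ (f %| 1)%Z.
  by have := prime_gt1 f_prime; rewrite dvdzE dvdn1; lia.
have betweenP := between_lineP w2 free_w f_prime c_def.
have dmodule := span_dmodule w2 free_w f_prime c_def.
split.
- split; first exact: (conductor_pow_span _ w2 free_w f_prime).
  by move=> i; apply: (conductor_pow_min free_w f_prime).
- move=> /dmodule fc.
  pose L (a : nat) := line f (f%:Z ^+ j.+1)%:~R (f%:R * (u%:~R + w)) a v.
  have L_inj a b : (a < f)%N -> (b < f)%N -> L a = L b -> a = b.
    exact: line_ndvd_inj.
  have JNL a : line f (f%:Z ^+ j.+1)%:~R (f%:R * (u%:~R + w)) 1 0 <> L a.
    exact: line_neq.
  rewrite (eq_imagel (fun a _ => JaE a fc)) JE -/L.
  set B := ideals_between _ _ _.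
  have BE : B = line f (f%:Z ^+ j.+1)%:~R (f%:R * (u%:~R + w)) 1 0
      |` [set L a | a in `I_f].
    apply/seteqP; split=> [I /betweenP[m [l [mlN0 _ ->]]]|I IL].
      have [fl|fNl] := boolP (f %| l)%Z.
        by left; apply: line_dvd.
      have [a af ->] := line_ndvd f_prime free_e m fNv fNl.
      by right; exists a.
    apply/betweenP; case: IL => [->|[a _ <-]].
      by exists 1, 0; rewrite negb_and fN1 mulr0 dvdz0.
    by exists a, v; rewrite negb_and fNv orbT dvdz_mulr.
  split.
  + pose h (i : nat) := if (i < f)%N then L i else
      line f (f%:Z ^+ j.+1)%:~R (f%:R * (u%:~R + w)) 1 0.
    have -> : B = h @` `I_f.+1.
      rewrite BE; apply/seteqP; split=> [I [->|[a af <-]]|_ [i i_le <-]].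
      * by exists f => //=; rewrite /h ltnn.
      * by exists a; [apply: ltnW|rewrite /h af].
      * by rewrite /h; case: ifP => [i_lt|_]; [right; exists i|left].
    apply: inj_card_eq => a b; rewrite !in_setE /= !ltnS /h => a_le b_le.
    case: (ltnP a f) => [a_lt|a_ge]; case: (ltnP b f) => [b_lt|b_ge].
    * exact: L_inj.
    * by move=> /esym/JNL.
    * by move=> /JNL.
    * move=> _; apply/eqP.
      by rewrite eqn_leq (leq_trans a_le b_ge) (leq_trans b_le a_ge).
  + exact: BE.
  + by move=> a _; rewrite JaE//; apply: JNL.
  + by move=> a b af bf; rewrite !JaE//; apply: L_inj.
move=> QNQD; have fNc : ~~ (f %| c)%Z by apply/negP => /dmodule/esym.
rewrite JE; split; last exact: (line10_scaled w2 f_prime c_def).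
apply/seteqP; split=> [I /betweenP[m [l [mlN0 cl ->]]]|_ ->].
  apply: (line_dvd f_prime free_e) => //.
  by move: cl; rewrite prime_dvdzM// (negbTE fNc).
by apply/betweenP; exists 1, 0; rewrite negb_and fN1 mulr0 dvdz0.
Qed.
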